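(* Let $A\in\mathbb{R}^{n\times n}$ be symmetric and let $u\in\mathbb{R}^n$ satisfy $u^TAu\neq 0$. For nonzero real $\gamma$, the equation $(u^TAu)\,\gamma^2+(u^Tu-u^TA^2u)\,\gamma-u^TAu=0$ is equivalent to $u^T(A+\gamma^{-1}I)(A-\gamma I)u=0$. Consequently, the homogeneous Rayleigh quotient $\alpha=\alpha_1/\alpha_2$ of $A$ at $u$ satisfies the nonlinear Galerkin condition $$(A-\alpha I)u\ \perp\ (A+\alpha^{-1}I)u,$$ or, in homogeneous coordinates, $(\alpha_2A-\alpha_1I)u\ \perp\ (\alpha_1A+\alpha_2I)u$.
   Context: $\|\cdot\|$ is the Euclidean norm and $\perp$ denotes orthogonality in the standard inner product. $\mathbb{P}_1(\mathbb{R})$ is the real projective line, i.e. $\mathbb{R}^2\setminus\{0\}$ modulo multiplication by nonzero scalars. For $u^TAu\ne0$ the minimizer $(\alpha_1,\alpha_2)\in\mathbb{P}_1(\mathbb{R})$ of $\frac{\|\alpha_1u-\alpha_2Au\|}{\sqrt{\alpha_1^2+\alpha_2^2}}$ is unique and has $\alpha_1,\alpha_2\ne0$; the homogeneous Rayleigh quotient of $A$ at $u$ is $\alpha=\alpha_1/\alpha_2$, explicitly $$\alpha=\frac{1}{2\,u^TAu}\Big[u^TA^2u-u^Tu+\sqrt{(u^TA^2u-u^Tu)^2+4(u^TAu)^2}\Big].$$ *)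

(* Defs.v *)
From mathcomp Require Import all_boot all_order all_algebra.
From mathcomp Require Import reals.
From mathcomp Require Import ring lra.

Set Implicit Arguments.
Unset Strict Implicit.
Unset Printing Implicit Defensive.

Import Order.TTheory GRing.Theory Num.Theory.
Local Open Scope ring_scope.

Definition dotp (R : realType) (n : nat) (u v : 'cV[R]_n) : R :=
  (u^T *m v) ord0 ord0.

(* In the analysis library the norm `|u| of a matrix is the sup norm. *)
Definition enorm (R : realType) (n : nat) (u : 'cV[R]_n) : R :=
  Num.sqrt (dotp u u).

Definition perp (R : realType) (n : nat) (u v : 'cV[R]_n) : Prop :=
  dotp u v = 0.

Definition quad (R : realType) (n : nat) (M : 'M[R]_n) (u : 'cV[R]_n) : R :=
  (u^T *m M *m u) ord0 ord0.

Definition hres (R : realType) (n : nat) (A : 'M[R]_n) (u : 'cV[R]_n)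
    (a1 a2 : R) : R :=
  enorm (a1 *: u - a2 *: (A *m u)) / Num.sqrt (a1 ^+ 2 + a2 ^+ 2).

(* (a1 : a2) minimizes hres over the real projective line, whose points are
   given by nonzero pairs of homogeneous coordinates; hres does not depend on
   the chosen representative (hresZ).  The homogeneous Rayleigh quotient of A
   at u is then a1 / a2. *)
Definition hrq_coords (R : realType) (n : nat) (A : 'M[R]_n) (u : 'cV[R]_n)
    (a1 a2 : R) : Prop :=
  (a1, a2) != (0, 0) /\
  forall b1 b2 : R, (b1, b2) != (0, 0) -> hres A u a1 a2 <= hres A u b1 b2.

Lemma hresZ (R : realType) (n : nat) (A : 'M[R]_n) (u : 'cV[R]_n)
    (t a1 a2 : R) :
  t != 0 -> hres A u (t * a1) (t * a2) = hres A u a1 a2.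
Proof.
move=> t0; rewrite /hres /enorm.
have -> : (t * a1) *: u - (t * a2) *: (A *m u)
          = t *: (a1 *: u - a2 *: (A *m u)).
  by rewrite -!scalerA scalerBr.
set w := _ - _.
have -> : dotp (t *: w) (t *: w) = t ^+ 2 * dotp w w.
  by rewrite /dotp [(t *: w)^T]linearZ -scalemxAl -scalemxAr !mxE expr2 mulrA.
have -> : (t * a1) ^+ 2 + (t * a2) ^+ 2 = t ^+ 2 * (a1 ^+ 2 + a2 ^+ 2) by ring.
rewrite !(@sqrtrM _ (t ^+ 2)) ?sqr_ge0// sqrtr_sqr -mulf_div divff ?mul1r//.
by rewrite normr_eq0.
Qed.

Lemma dotp_ge0 (R : realType) (n : nat) (u : 'cV[R]_n) : 0 <= dotp u u.
Proof. by rewrite /dotp mxE sumr_ge0// => i _; rewrite mxE -expr2 sqr_ge0. Qed.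

Lemma dotp_residual (R : realType) (n : nat) (A : 'M[R]_n) (u : 'cV[R]_n)
    (x y : R) :
  A^T = A ->
  dotp (x *: u - y *: (A *m u)) (x *: u - y *: (A *m u)) =
  dotp u u * x ^+ 2 - 2 * quad A u * x * y + quad (A *m A) u * y ^+ 2.
Proof.
move=> sA; rewrite /dotp /quad.
have -> : (x *: u - y *: (A *m u))^T = x *: u^T - y *: (u^T *m A).
  by rewrite linearB !linearZ /= trmx_mul sA.
rewrite mulmxBl !mulmxBr -!scalemxAl -!scalemxAr !mulmxA.
have E (B C : 'M[R]_1) (t : R) : ((B - C) ord0 ord0 = B ord0 ord0 - C ord0 ord0)
    * ((t *: B) ord0 ord0 = t * B ord0 ord0) by rewrite !mxE.
rewrite !(fun B C => (E B C 0).1) !(fun B t => (E B 0 t).2); ring.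
Qed.

(* When u^T A u <> 0 the minimizer exists, is unique in the projective line,
   has nonzero coordinates, and its quotient is given in closed form. *)
Lemma hrq_coordsP (R : realType) (n : nat) (A : 'M[R]_n) (u : 'cV[R]_n)
    (a1 a2 : R) :
  A^T = A -> quad A u != 0 ->
  let d := quad (A *m A) u - dotp u u in
  hrq_coords A u a1 a2 <->
  [/\ a1 != 0, a2 != 0 &
      a1 / a2 = (2 * quad A u)^-1 *
                (d + Num.sqrt (d ^+ 2 + 4 * quad A u ^+ 2))].
Proof.
move=> sA b0 d.
have NE x y : 0 <= dotp u u * x ^+ 2 - 2 * quad A u * x * y
             + quad (A *m A) u * y ^+ 2.
  by rewrite -dotp_residual ?dotp_ge0.
have HE x y : hres A u x y =
    Num.sqrt ((dotp u u * x ^+ 2 - 2 * quad A u * x * y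
               + quad (A *m A) u * y ^+ 2) / (x ^+ 2 + y ^+ 2)).
  rewrite /hres /enorm dotp_residual// [RHS]sqrtrM ?NE//.
  by rewrite sqrtrV ?addr_ge0 ?sqr_ge0.
rewrite /d /hrq_coords {d}.
move: b0 HE NE; set a := dotp u u; set b := quad A u; set c := quad _ u.
move=> b0 HE NE; set d := c - a; set s := Num.sqrt _.
have b2 : 0 < b ^+ 2 by rewrite exprn_even_gt0.
have sE : s ^+ 2 = d ^+ 2 + 4 * b ^+ 2.
  by rewrite sqr_sqrtr// addr_ge0 ?sqr_ge0// mulr_ge0 ?sqr_ge0.
have s0 : 0 <= s by rewrite sqrtr_ge0.
pose p := s - d.
have dlts : `|d| < s.
  by rewrite -(ltr_pXn2r (n := 2)) ?nnegrE// real_normK ?num_real// sE; lra.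
have p0 : 0 < p by rewrite /p subr_gt0; exact: le_lt_trans (ler_norm d) dlts.
have q0 : 0 < d + s by have := ler_norm (- d); rewrite normrN; lra.
have pq : p * (d + s) = 4 * b ^+ 2.
  have -> : p * (d + s) = s ^+ 2 - d ^+ 2 by rewrite /p; ring.
  by rewrite sE; ring.
have p0' : p != 0 by rewrite gt_eqF.
have alphaE : (2 * b)^-1 * (d + s) = 2 * b / p.
  have -> : d + s = 4 * b ^+ 2 / p by rewrite -pq; field.
  by field; rewrite b0 p0'.
pose N x y := a * x ^+ 2 - 2 * b * x * y + c * y ^+ 2.
pose l := (a + c - s) / 2.
have ND x y : N x y = l * (x ^+ 2 + y ^+ 2) + (p * x - 2 * b * y) ^+ 2 / (2 * p).
  have -> : (p * x - 2 * b * y) ^+ 2 / (2 * p) =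
     (p * x ^+ 2 - 4 * b * x * y + (4 * b ^+ 2 / p) * y ^+ 2) / 2 by field.
  have -> : 4 * b ^+ 2 / p = d + s by rewrite -pq; field.
  by rewrite /N /l /p /d; field.
have Sgt (x y : R) : (x, y) != (0, 0) -> 0 < x ^+ 2 + y ^+ 2.
  rewrite xpair_eqE negb_and => /orP[] h0.
    by apply: ltr_wpDr; rewrite ?sqr_ge0 ?exprn_even_gt0.
  by apply: ltr_wpDl; rewrite ?sqr_ge0 ?exprn_even_gt0.
have HN (x y : R) : (x, y) != (0, 0) ->
    hres A u x y =
    Num.sqrt (l + (p * x - 2 * b * y) ^+ 2 / (2 * p) / (x ^+ 2 + y ^+ 2)).
  move=> /Sgt S0; rewrite HE -/(N x y) ND mulrDl mulfK//; exact: lt0r_neq0.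
have hit (x y : R) : y != 0 -> (x / y == 2 * b / p) = (p * x - 2 * b * y == 0).
  by move=> y0; rewrite eqr_div// subr_eq0 mulrC.
rewrite alphaE; split.
- case=> xy0 /(_ (2 * b) p).
  have bp0 : (2 * b, p) != (0, 0) by rewrite xpair_eqE negb_and p0' orbT.
  rewrite !HN// (_ : p * (2 * b) - 2 * b * p = 0); last by ring.
  rewrite expr0n /= !mul0r addr0 => /(_ bp0) le.
  have S0 := Sgt _ _ xy0.
  have E : p * a1 - 2 * b * a2 = 0.
    apply/eqP/negPn/negP => ne.
    have t0 : 0 < (p * a1 - 2 * b * a2) ^+ 2 / (2 * p) / (a1 ^+ 2 + a2 ^+ 2).
      by do 2!apply: divr_gt0 => //; [rewrite exprn_even_gt0 | lra].
    have l0 : 0 <= l.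
      have := NE (2 * b) p; rewrite -/(N _ _) ND.
      rewrite (_ : p * (2 * b) - 2 * b * p = 0); last by ring.
      by rewrite expr0n /= mul0r addr0 pmulr_lge0// Sgt.
    by move: le; rewrite ler_sqrt//; lra.
  have a20 : a2 != 0.
    apply/eqP => a20; move: E xy0; rewrite a20 mulr0 subr0 xpair_eqE eqxx andbT.
    by move=> /eqP; rewrite mulf_eq0 (negPf p0') /= => ->.
  split=> //; last by apply/eqP; rewrite hit// E.
  apply/eqP => a10; move: E; rewrite a10 mulr0 sub0r => /eqP.
  by rewrite oppr_eq0 !mulf_eq0 (negPf b0) (negPf a20) pnatr_eq0.
- case=> a10 a20 /eqP; rewrite hit// => /eqP E.
  have xy0 : (a1, a2) != (0, 0) by rewrite xpair_eqE negb_and a10.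
  split=> // x y xy; rewrite !HN// E expr0n /= !mul0r addr0.
  apply: ler_wsqrtr; rewrite lerDl; apply: divr_ge0; last exact/ltW/Sgt.
  by apply: divr_ge0; [rewrite sqr_ge0 | lra].
Qed.

(* Main.v *)
Require Import Defs.
From mathcomp Require Import all_boot all_order all_algebra.
From mathcomp Require Import reals.
From mathcomp Require Import ring.

Set Implicit Arguments.
Unset Strict Implicit.
Unset Printing Implicit Defensive.

Import Order.TTheory GRing.Theory Num.Theory.
Local Open Scope ring_scope.

(** Since [A] is symmetric, $u^T(A+\gamma^{-1}I)(A-\gamma I)u$ is the inner product of $(A-\gamma
    I)u$ and $(A+\gamma^{-1}I)u$. Expanded by [dotp_pencil], it is the quadratic in $\gamma$ divided
    by $-\gamma$, so the two vanish together. The closed form of the homogeneous Rayleigh quotient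
    is a root of this quadratic ([hrq_quadratic]), which gives both orthogonality relations. *)

Lemma quad_mulmx (R : realType) (n : nat) (M N : 'M[R]_n) (u : 'cV[R]_n) :
  quad (M *m N) u = dotp (M^T *m u) (N *m u).
Proof. by rewrite /quad /dotp trmx_mul trmxK !mulmxA. Qed.

Lemma dotpC (R : realType) (n : nat) (u v : 'cV[R]_n) : dotp u v = dotp v u.
Proof. by rewrite /dotp !mxE; apply: eq_bigr => i _; rewrite !mxE mulrC. Qed.

(** Bilinearity, with symmetry of [A] turning both cross terms into multiples of [quad A u]. Four
    free coefficients let it serve the affine and the homogeneous condition alike. *)
Lemma dotp_pencil (R : realType) (n : nat) (A : 'M[R]_n) (u : 'cV[R]_n)
    (a b c d : R) :
  A^T = A ->
  dotp ((a *: A + b%:M) *m u) ((c *: A + d%:M) *m u) =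
  a * c * quad (A *m A) u + (a * d + b * c) * quad A u + b * d * dotp u u.
Proof.
move=> symA; rewrite /dotp /quad trmx_mul linearD /= linearZ /= symA tr_scalar_mx.
rewrite mulmxDr mulmxDl !mulmxDl !mulmxDr -!scalemxAr -!scalemxAl.
rewrite !mul_scalar_mx !mul_mx_scalar -!scalemxAr -!scalemxAl !mulmxA.
by rewrite !mxE; ring.
Qed.

(** The closed form in [hrq_coordsP] is the quadratic formula with the plus sign;
    [d ^+ 2 + 4 * b ^+ 2] is the discriminant. *)
Lemma hrq_quadratic (R : realType) (n : nat) (A : 'M[R]_n) (u : 'cV[R]_n)
    (a1 a2 : R) :
  A^T = A -> quad A u != 0 -> hrq_coords A u a1 a2 ->
  quad A u * (a1 / a2) ^+ 2
    + (dotp u u - quad (A *m A) u) * (a1 / a2) - quad A u = 0.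
Proof.
move=> symA b0 /(hrq_coordsP _ _ symA b0)[_ _ ->].
set b := quad A u in b0 *; set d := _ - dotp u u; set s := Num.sqrt _.
have s2 : s ^+ 2 = d ^+ 2 + 4 * b ^+ 2.
  by rewrite sqr_sqrtr// addr_ge0 ?sqr_ge0// mulr_ge0 ?sqr_ge0.
rewrite -[dotp u u - _]opprB -/d.
(* At [(d + s) / (2 * b)] the terms linear in [s] cancel. *)
transitivity ((s ^+ 2 - d ^+ 2 - 4 * b ^+ 2) / (4 * b)); first by field.
by rewrite s2 (_ : _ - _ - _ = 0) ?mul0r//; ring.
Qed.

Theorem mainTheorem2 (R : realType) (n : nat) (A : 'M[R]_n) (u : 'cV[R]_n)
    (symA : A^T = A) (uAu_neq0 : quad A u != 0) :
  (forall gamma : R, gamma != 0 ->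
     quad A u * gamma ^+ 2 + (dotp u u - quad (A *m A) u) * gamma - quad A u = 0
     <-> quad ((A + gamma^-1%:M) *m (A - gamma%:M)) u = 0) /\
  (forall alpha1 alpha2 : R, hrq_coords A u alpha1 alpha2 ->
     let alpha := alpha1 / alpha2 in
     perp ((A - alpha%:M) *m u) ((A + alpha^-1%:M) *m u) /\
     perp ((alpha2 *: A - alpha1%:M) *m u) ((alpha1 *: A + alpha2%:M) *m u)).
Proof.
set q := quad A u in uAu_neq0 *; set q2 := quad (A *m A) u.
have galerkin (g : R) : g != 0 ->
    dotp ((A - g%:M) *m u) ((A + g^-1%:M) *m u) =
    - (q * g ^+ 2 + (dotp u u - q2) * g - q) / g.
  move=> g0; rewrite -{1 2}(scale1r A) -raddfN dotp_pencil// -/q -/q2.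
  by field.
split=> [g g0|a1 a2 ha alpha].
  (* Symmetry lets the left factor move across the inner product unchanged. *)
  rewrite quad_mulmx linearD /= symA tr_scalar_mx dotpC galerkin//.
  split=> [->|/eqP]; first by rewrite oppr0 mul0r.
  by rewrite mulf_eq0 oppr_eq0 invr_eq0 (negPf g0) orbF => /eqP.
have [a10 a20 _] := (hrq_coordsP _ _ symA uAu_neq0).1 ha.
have E : q * alpha ^+ 2 + (dotp u u - q2) * alpha - q = 0.
  exact: hrq_quadratic.
split; rewrite /perp.
  by rewrite galerkin ?mulf_neq0 ?invr_eq0// E oppr0 mul0r.
rewrite -raddfN dotp_pencil// -/q -/q2.
(* As [a1 = alpha * a2], clearing denominators homogenizes the quadratic. *)
transitivity (- a2 ^+ 2 * (q * alpha ^+ 2 + (dotp u u - q2) * alpha - q)).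
  by rewrite /alpha; field.
by rewrite E mulr0.
Qed.
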